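(* Let $M$ be a Weingarten hyperbolic rotational surface of the second kind in $\mathbb{S}^3_1$, with profile curve parameterized by the principal curvature $\lambda$, whose principal curvatures satisfy $\kappa=\frac a\lambda$ with constant $a$. Then the coordinate functions of the profile curve of $M$ with constant Gaussian curvature in $\mathbb{S}^3_1$, parameterized with respect to $\lambda$, are given by $$w(\lambda)=\frac{c}{\sqrt{\lambda^2+a}},\quad x(\lambda)=\sqrt{1-w^2(\lambda)}\cos\phi(\lambda),\quad y(\lambda)=\sqrt{1-w^2(\lambda)}\sin\phi(\lambda),$$ where $$\phi(\lambda)=\phi_0\pm c^2\int\frac{\lambda^2\,d\lambda}{(\lambda^2+a-c^2)\sqrt{\lambda^2+a}\sqrt{(1-c^2)\lambda^2+a-c^2}}$$ for constants $\phi_0$ and $c>0$, with i) $\lambda<-\sqrt{\frac{c^2-a}{1-c^2}}$ or $\lambda>\sqrt{\frac{c^2-a}{1-c^2}}$ for $a<c^2<1$ with $a<1$; ii) $-\sqrt{\frac{a-c^2}{c^2-1}}<\lambda<\sqrt{\frac{a-c^2}{c^2-1}}$ for $1<c^2<a$ with $a>1$; iii) $\lambda\in\mathbb{R}$ if $c^2\le\min\{a,1\}$.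
   Context: $\mathbb{E}^4_1$ is 4-dimensional Minkowski space with metric $\tilde g(\mathbf{x},\mathbf{y})=x_1y_1+x_2y_2+x_3y_3-x_4y_4$, and $\mathbb{S}^3_1=\{\mathbf{x}\in\mathbb{E}^4_1:\tilde g(\mathbf{x},\mathbf{x})=1\}$ is de Sitter space. A hyperbolic rotational surface of the second kind is $r(u,v)=(x(u),y(u),w(u)\cosh v,w(u)\sinh v)$, $u\in J$, $v\in\mathbb{R}$, where $u$ is the arc length parameter of the profile curve, $w>0$, $x^2+y^2+w^2=1$, $x'^2+y'^2+w'^2=1$ ($'=d/du$); the induced metric is $du^2-w^2dv^2$, so it is timelike. It is assumed not contained in a hyperplane of $\mathbb{E}^4_1$, and $x',y'$ are nonzero. ''Parameterized with respect to $\lambda$'' means $\lambda$ replaces $u$ as parameter of the profile curve. Principal curvatures: with $N$ a unit normal field of the surface in $\mathbb{S}^3_1$, $\kappa=\tilde g(r_{uu},N)$ and $\lambda=\tilde g(r_{vv},N)/|\tilde g(r_v,r_v)|=\tilde g(r_{vv},N)/w^2$; the eigenvalues of the shape operator are $\kappa,-\lambda$. Convention: $\lambda$ ranges over an open interval on which the displayed expressions are real and well defined, i.e. $\lambda^2+a>0$, $\lambda^2+a-c^2\ne0$ and $(1-c^2)\lambda^2+a-c^2>0$. The integral denotes an antiderivative in $\lambda$. *)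

(* Defs.v *)
From HB Require Import structures.
From mathcomp Require Import all_boot all_order all_algebra.
From mathcomp Require Import all_classical all_reals all_analysis.
Set Implicit Arguments.
Unset Strict Implicit.
Unset Printing Implicit Defensive.
Import Order.TTheory GRing.Theory Num.Theory.
Import numFieldNormedType.Exports.
Local Open Scope classical_set_scope.
Local Open Scope ring_scope.

Section Definitions.
Context {R : realType}.

Definition cosh (t : R) : R := (expR t + expR (- t)) / 2.
Definition sinh (t : R) : R := (expR t - expR (- t)) / 2.

(* Metric of E^4_1: signature (+,+,+,-), the last coordinate being timelike. *)
Definition mink (p q : 'rV[R]_4) : R :=
  \sum_(i < 4) (-1) ^+ (i == 3%N :> nat) * (p 0 i * q 0 i).

Definition is_hyperplane (H : set 'rV[R]_4) : Prop :=
  exists (A : 'rV[R]_4) (d : R), A != 0 /\ H = [set p | mink A p = d].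

Definition open_interval (J : set R) : Prop :=
  [/\ J !=set0, open J & is_interval J].

Definition C2_on (J : set R) (f : R -> R) : Prop :=
  forall u, J u -> [/\ derivable f u 1, derivable (derive1 f) u 1 &
                       {for u, continuous (derive1n 2 f)}].

Definition surf (x y w : R -> R) (u v : R) : 'rV[R]_4 :=
  \row_(i < 4) [:: x u; y u; w u * cosh v; w u * sinh v]`_i.

Definition image_surf (J : set R) (r : R -> R -> 'rV[R]_4) : set 'rV[R]_4 :=
  [set p | exists u v, J u /\ p = r u v].

Definition d_u (r : R -> R -> 'rV[R]_4) (u v : R) : 'rV[R]_4 :=
  derive1 (fun s => r s v) u.
Definition d_v (r : R -> R -> 'rV[R]_4) (u v : R) : 'rV[R]_4 :=
  derive1 (r u) v.

(* "x', y' are nonzero" is required only in the sense that neither function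
   vanishes identically; they may have isolated zeros. *)
Record hyp_rot_surface2 (J : set R) (x y w : R -> R) : Prop := {
  hrs_dom    : open_interval J;
  hrs_reg    : [/\ C2_on J x, C2_on J y & C2_on J w];
  hrs_pos    : forall u, J u -> 0 < w u;
  hrs_sphere : forall u, J u -> x u ^+ 2 + y u ^+ 2 + w u ^+ 2 = 1;
  hrs_arclen : forall u, J u ->
    derive1 x u ^+ 2 + derive1 y u ^+ 2 + derive1 w u ^+ 2 = 1;
  hrs_dx     : exists u, J u /\ derive1 x u != 0;
  hrs_dy     : exists u, J u /\ derive1 y u != 0;
  hrs_full   : forall H, is_hyperplane H ->
    ~ image_surf J (surf x y w) `<=` H
}.

(* [mink (N u v) (r u v) = 0] says that N is tangent to S^3_1; continuity
   prevents N from switching between the two choices of unit normal. *)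
Record unit_normal_field (J : set R) (r N : R -> R -> 'rV[R]_4) : Prop := {
  unf_cont : forall u v, J u ->
    {for (u, v), continuous (fun p : R * R => N p.1 p.2)};
  unf_unit : forall u v, J u -> mink (N u v) (N u v) = 1;
  unf_tan  : forall u v, J u -> mink (N u v) (r u v) = 0;
  unf_u    : forall u v, J u -> mink (N u v) (d_u r u v) = 0;
  unf_v    : forall u v, J u -> mink (N u v) (d_v r u v) = 0
}.

Definition kappa (r N : R -> R -> 'rV[R]_4) (u v : R) : R :=
  mink (d_u (d_u r) u v) (N u v).

Definition lambda (r N : R -> R -> 'rV[R]_4) (u v : R) : R :=
  mink (d_v (d_v r) u v) (N u v) / `|mink (d_v r u v) (d_v r u v)|.

(* Gauss equation in S^3_1, which has constant curvature 1: as N is spacelike,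
   K = 1 + det S, where the shape operator S has eigenvalues kappa, -lambda. *)
Definition gauss_curvature (r N : R -> R -> 'rV[R]_4) (u v : R) : R :=
  1 + kappa r N u v * - lambda r N u v.

(* Weingarten relation kappa = f(lambda). *)
Definition weingarten (J : set R) (r N : R -> R -> 'rV[R]_4) (f : R -> R) :=
  forall u v, J u -> kappa r N u v = f (lambda r N u v).

(* [U] is the change of parameter expressing the arc length u in terms of
   lambda; differentiability of [U] makes it a regular one, since lambda is
   itself differentiable in u. *)
Record lambda_parameter (J I : set R) (r N : R -> R -> 'rV[R]_4)
    (U : R -> R) : Prop := {
  lp_dom : open_interval I;
  lp_bij : set_bij I J U;
  lp_der : forall l, I l -> derivable U l 1;
  lp_inv : forall l v, I l -> lambda r N (U l) v = l
}.

Definition phi_integrand (a c l : R) : R :=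
  l ^+ 2 / ((l ^+ 2 + a - c ^+ 2) * Num.sqrt (l ^+ 2 + a)
            * Num.sqrt ((1 - c ^+ 2) * l ^+ 2 + a - c ^+ 2)).

Definition antiderivative_on (I : set R) (F f : R -> R) : Prop :=
  forall l, I l -> is_derive l 1 F (f l).

(* In the third case lambda is unrestricted. *)
Definition lambda_range (a c : R) (I : set R) : Prop :=
  [\/ [/\ a < c ^+ 2, c ^+ 2 < 1, a < 1 &
        forall l, I l -> l < - Num.sqrt ((c ^+ 2 - a) / (1 - c ^+ 2)) \/
                         Num.sqrt ((c ^+ 2 - a) / (1 - c ^+ 2)) < l],
      [/\ 1 < c ^+ 2, c ^+ 2 < a, 1 < a &
        forall l, I l -> - Num.sqrt ((a - c ^+ 2) / (c ^+ 2 - 1)) < l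
                         < Num.sqrt ((a - c ^+ 2) / (c ^+ 2 - 1))] |
      c ^+ 2 <= Num.min a 1].

End Definitions.

(* Main.v *)
(** Write p = (x, y, w) for the profile curve, a unit speed curve on the unit
    sphere; p, p' and n = p x p' form an orthonormal frame and p'' = -p + k n.
    At v = 0 the unit normal of the surface is e (n, 0) with e = +-1, so that
    kappa = e k and lambda w = e n3, where n3 = x y' - y x'.  The relation
    kappa lambda = a reads k n3 = a w; together with n3' = - k w' it makes
    n3^2 + a w^2 = w^2 (lambda^2 + a) a constant c^2.  Differentiating
    w^2 (lambda^2 + a) = c^2 in lambda gives w' du/dlambda, orthonormality of
    the frame gives w'^2 = 1 - w^2 - n3^2, and the polar angle of (x, y) has
    u-derivative n3 / (1 - w^2); multiplying by du/dlambda yields the integrand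
    up to a sign, which is constant because lambda n3 w' never vanishes. *)

Require Import Defs.
From mathcomp Require Import all_boot all_order all_algebra.
From mathcomp Require Import all_classical all_reals all_analysis.
From mathcomp Require Import ring lra.
Import Order.TTheory GRing.Theory Num.Theory.
Import numFieldNormedType.Exports.
Local Open Scope classical_set_scope.
Local Open Scope ring_scope.

(** * Partial derivatives of the surface and Minkowski products at v = 0 *)

Lemma derive1_row (R : realType) (n : nat) (f : R -> 'rV[R]_n) (df : 'rV[R]_n)
    (t : R) (hf : forall j, is_derive t 1 (fun s => f s 0 j) (df 0 j)) :
  derive1 f t = df.
Proof.
have fD : derivable f t 1 by apply/derivable_mxP => i j; rewrite ord1; case: (hf j).
rewrite derive1E derive_mx//; apply/rowP => j; rewrite mxE.
by case: (hf j).
Qed.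

Lemma is_derive_cosh (R : realType) (t : R) : is_derive t 1 (@cosh R) (sinh t).
Proof.
rewrite /cosh /sinh; apply: is_derive_eq.
rewrite /GRing.scale/=; ring.
Qed.

Lemma is_derive_sinh (R : realType) (t : R) : is_derive t 1 (@sinh R) (cosh t).
Proof.
rewrite /cosh /sinh; apply: is_derive_eq.
rewrite /GRing.scale/=; ring.
Qed.

Lemma cosh0 (R : realType) : cosh 0 = 1 :> R.
Proof. by rewrite /cosh oppr0 expR0; field. Qed.

Lemma sinh0 (R : realType) : sinh 0 = 0 :> R.
Proof. by rewrite /sinh oppr0 expR0; field. Qed.

Lemma d_u_surf (R : realType) (x y w : R -> R) (u v : R)
    (hx : derivable x u 1) (hy : derivable y u 1) (hw : derivable w u 1) :
  d_u (surf x y w) u v = surf (derive1 x) (derive1 y) (derive1 w) u v.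
Proof.
have dx := derivableP hx; have dy := derivableP hy; have dw := derivableP hw.
rewrite -!derive1E in dx dy dw.
apply: derive1_row => j; rewrite mxE.
under eq_fun do rewrite mxE.
case: j => -[|[|[|[|//]]]] /= _; [exact: dx | exact: dy | |].
  by apply: is_derive_eq; rewrite /GRing.scale/=; ring.
by apply: is_derive_eq; rewrite /GRing.scale/=; ring.
Qed.

Lemma minkE (R : realType) (p q : 'rV[R]_4) :
  mink p q = p 0 0 * q 0 0 + p 0 1 * q 0 1 + p 0 (inord 2) * q 0 (inord 2)
             - p 0 (inord 3) * q 0 (inord 3).
Proof.
rewrite /mink !big_ord_recl big_ord0.
rewrite (_ : inord 2 = lift ord0 (lift ord0 ord0)); last first.
  by apply/val_inj; rewrite /= inordK.
rewrite (_ : inord 3 = lift ord0 (lift ord0 (lift ord0 ord0))); last first.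
  by apply/val_inj; rewrite /= inordK.
rewrite (_ : 1 = lift ord0 ord0 :> 'I_4); last by apply/val_inj.
rewrite (_ : 0 = ord0 :> 'I_4); last by apply/val_inj.
by rewrite /=; ring.
Qed.

(** Since sinh 0 = 0, products with the surface reduce at v = 0 to Euclidean products with the
    profile curve. For this reason the curvatures are computed only at v = 0. *)
Lemma mink_surf0 (R : realType) (x y w : R -> R) (u : R) (q : 'rV[R]_4) :
  mink (surf x y w u 0) q = x u * q 0 0 + y u * q 0 1 + w u * q 0 (inord 2).
Proof. by rewrite minkE !mxE /= !inordK//= cosh0 sinh0; ring. Qed.

Lemma d_v_surf (R : realType) (x y w : R -> R) (u v : R) :
  d_v (surf x y w) u v =
  \row_(i < 4) [:: 0; 0; w u * sinh v; w u * cosh v]`_i.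
Proof.
apply: derive1_row => j; rewrite mxE.
under eq_fun do rewrite mxE.
have dch := is_derive_cosh R v; have dsh := is_derive_sinh R v.
case: j => -[|[|[|[|//]]]] /= _; [exact: is_derive_cst | exact: is_derive_cst | |].
- by apply: is_derive_eq; rewrite /GRing.scale/=; ring.
- by apply: is_derive_eq; rewrite /GRing.scale/=; ring.
Qed.

(** The functions cosh and sinh are their own second derivatives. Writing the result again as a
    [surf] makes [mink_surf0] applicable to it. *)
Lemma d_vv_surf (R : realType) (x y w : R -> R) (u v : R) :
  d_v (d_v (surf x y w)) u v = surf (cst 0) (cst 0) w u v.
Proof.
rewrite [LHS](_ : _ = derive1 (d_v (surf x y w) u) v)//.
rewrite (funext (@d_v_surf R x y w u)).
apply: derive1_row => j; rewrite mxE.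
under eq_fun do rewrite mxE.
have dch := is_derive_cosh R v; have dsh := is_derive_sinh R v.
case: j => -[|[|[|[|//]]]] /= _; [exact: is_derive_cst | exact: is_derive_cst | |].
- by apply: is_derive_eq; rewrite /GRing.scale/=; ring.
- by apply: is_derive_eq; rewrite /GRing.scale/=; ring.
Qed.

Lemma d_uu_surf (R : realType) (J : set R) (x y w : R -> R) (u v : R)
    (oJ : open J) (hx : C2_on J x) (hy : C2_on J y) (hw : C2_on J w) (Ju : J u) :
  d_u (d_u (surf x y w)) u v =
  surf (derive1 (derive1 x)) (derive1 (derive1 y)) (derive1 (derive1 w)) u v.
Proof.
have [[_ hx2 _] [_ hy2 _] [_ hw2 _]] := And3 (hx u Ju) (hy u Ju) (hw u Ju).
rewrite -(d_u_surf _ _ _ _ _ v hx2 hy2 hw2) [LHS]derive1E [RHS]derive1E.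
(* The outer derivative needs the formula for the inner one near [u], not only at [u]; openness of
   [J] provides it. *)
apply: near_eq_derive; near=> s; have Js : J s by near: s; exact: open_nbhs_nbhs.
have [[? _ _] [? _ _] [? _ _]] := And3 (hx s Js) (hy s Js) (hw s Js).
exact: d_u_surf.
Unshelve. all: by end_near. Qed.

(** * Calculus on intervals *)

Lemma is_derive_cst_on (R : realType) (J : set R) (f : R -> R)
    (iJ : is_interval J) (df : forall u, J u -> is_derive u 1 f 0) (u v : R) :
  J u -> J v -> f u = f v.
Proof.
wlog uv : u v / u <= v.
  by move=> H Ju Jv; case: (leP u v) => [|/ltW] h; [apply: H|apply/esym/H].
move=> Ju Jv; apply/esym/eqP; rewrite -subr_eq0; apply/eqP.
have JI z : z \in `[u, v] -> J z by rewrite in_itv; exact: iJ.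
have [||c _ ->] := @MVT_segment _ f (fun=> 0) u v uv; last by rewrite mul0r.
  by move=> z zuv; apply/df/JI; apply: subset_itv_oo_cc.
by apply: derivable_within_continuous => z /JI/df[].
Qed.

(** Two values of opposite sign would force a zero between them, by the intermediate value theorem.
    This later fixes the sign in front of the integral. *)
Lemma continuous_neq0_sign (R : realType) (J : set R) (f : R -> R)
    (iJ : is_interval J) (cf : forall u, J u -> {for u, continuous f})
    (f0 : forall u, J u -> f u != 0) :
  exists s : bool, forall u, J u -> f u = (-1) ^+ s * `|f u|.
Proof.
have H u v : J u -> J v -> f u < 0 < f v -> False.
  move=> Ju Jv /andP[fu fv].
  have JI z : z \in `[Num.min u v, Num.max u v] -> J z.
    rewrite in_itv/= => h; have [uv|/ltW vu] := leP u v.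
      by apply: (iJ u v) => //; move: h; rewrite min_l// max_r.
    by apply: (iJ v u) => //; move: h; rewrite min_r// max_l.
  have mM : Num.min u v <= Num.max u v by rewrite ge_min le_max lexx.
  have [||c /JI/f0/eqP//] := @IVT _ f _ _ 0 mM.
    by apply: continuous_in_subspaceT => z /set_mem/JI/cf.
  by rewrite ge_min le_max; case: (leP u v); rewrite (ltW fu) (ltW fv) ?orbT.
have [[u [Ju fu]]|neg] := pselect (exists u, J u /\ 0 < f u).
  exists false => v Jv; rewrite mul1r gtr0_norm//.
  have := f0 v Jv; rewrite neq_lt => /orP[fv|//].
  by case: (H v u); rewrite ?fu ?fv.
exists true => v Jv; rewrite expr1 mulN1r ler0_norm ?opprK// leNgt.
by apply/negP => ?; apply: neg; exists v.
Qed.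

(** The sine of [acos p] is |q|, so [acos p] serves for q >= 0 and its opposite for q < 0. *)
Lemma unit_circle_angle (R : realType) (p q : R) (pq : p ^+ 2 + q ^+ 2 = 1) :
  exists t : R, cos t = p /\ sin t = q.
Proof.
have p1 : -1 <= p <= 1.
  by rewrite -ler_norml -(expr_le1 (n := 2))// -normrX
    ger0_norm ?sqr_ge0// -pq lerDl sqr_ge0.
have q2 : Num.sqrt (1 - p ^+ 2) = `|q| by rewrite -pq addrC addKr sqrtr_sqr.
have [q0|/ltW q0] := leP 0 q.
  by exists (acos p); rewrite acosK// sin_acos// q2 ger0_norm.
by exists (- acos p); rewrite cosN sinN acosK// sin_acos// q2 ler0_norm// opprK.
Qed.

Lemma mink_d_v_surf0 (R : realType) (x y w : R -> R) (u : R) (q : 'rV[R]_4) :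
  mink (d_v (surf x y w) u 0) q = - w u * q 0 (inord 3).
Proof. by rewrite d_v_surf minkE !mxE /= !inordK//= cosh0 sinh0; ring. Qed.

(** On an open set [f] agrees near [u] with a constant function. This is how the sphere equation,
    the arc length condition and the relation between w and lambda get differentiated. *)
Lemma is_derive_eq0_on (R : realType) (J : set R) (f : R -> R) (u c d : R)
    (oJ : open J) (Ju : J u) (hf : forall t, J t -> f t = c)
    (df : is_derive u 1 f d) : d = 0.
Proof.
case: df => _ <-; rewrite (@near_eq_derive _ _ _ f (cst c)) ?derive_cst//.
by near=> t; apply: hf; near: t; exact: open_nbhs_nbhs.
Unshelve. all: by end_near. Qed.

(** * Orthonormal frames in Euclidean 3-space *)

(** The expansion of (a, b, c) in the orthonormal basis formed by p = (x, y, w), p' = (x1, y1, w1)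
    and their cross product. *)
Lemma frame_decomposition (R : realType) (x y w x1 y1 w1 a b c : R)
    (hp : x ^+ 2 + y ^+ 2 + w ^+ 2 = 1) (hd : x1 ^+ 2 + y1 ^+ 2 + w1 ^+ 2 = 1)
    (hpd : x * x1 + y * y1 + w * w1 = 0) :
  let p := a * x + b * y + c * w in
  let q := a * x1 + b * y1 + c * w1 in
  let e := a * (y * w1 - w * y1) + b * (w * x1 - x * w1) + c * (x * y1 - y * x1) in
  [/\ a = p * x + q * x1 + e * (y * w1 - w * y1),
      b = p * y + q * y1 + e * (w * x1 - x * w1) &
      c = p * w + q * w1 + e * (x * y1 - y * x1)].
Proof.
move=> p q e.
(* By Lagrange's identity the bracket is the squared norm of the cross product, here equal to 1. *)
have G t : t = t * ((x ^+ 2 + y ^+ 2 + w ^+ 2) * (x1 ^+ 2 + y1 ^+ 2 + w1 ^+ 2)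
    - (x * x1 + y * y1 + w * w1) ^+ 2) by rewrite hp hd hpd; ring.
have Gp t : t = t * (x1 ^+ 2 + y1 ^+ 2 + w1 ^+ 2) by rewrite hd mulr1.
have Gq t : t = t * (x ^+ 2 + y ^+ 2 + w ^+ 2) by rewrite hp mulr1.
have H t : t * (x * x1 + y * y1 + w * w1) = 0 by rewrite hpd mulr0.
split.
(* Factors equal to 1 and multiples of the zero product p.p' are inserted until both sides agree as
   polynomials. *)
- rewrite [LHS]G [p * x]Gp -[p * x * _]subr0 -(H (p * x1)) [q * x1]Gq.
  rewrite -[q * x1 * _]subr0 -(H (q * x)) /p /q /e; ring.
- rewrite [LHS]G [p * y]Gp -[p * y * _]subr0 -(H (p * y1)) [q * y1]Gq.
  rewrite -[q * y1 * _]subr0 -(H (q * y)) /p /q /e; ring.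
- rewrite [LHS]G [p * w]Gp -[p * w * _]subr0 -(H (p * w1)) [q * w1]Gq.
  rewrite -[q * w1 * _]subr0 -(H (q * w)) /p /q /e; ring.
Qed.

(** Orthogonality to p and p' leaves only the component [e] along the cross product, and the unit
    norm forces e^2 = 1. *)
Lemma unit_normal_cross (R : realType) (x y w x1 y1 w1 a b c : R)
    (hp : x ^+ 2 + y ^+ 2 + w ^+ 2 = 1) (hd : x1 ^+ 2 + y1 ^+ 2 + w1 ^+ 2 = 1)
    (hpd : x * x1 + y * y1 + w * w1 = 0)
    (ha : a * x + b * y + c * w = 0) (hb : a * x1 + b * y1 + c * w1 = 0)
    (hm : a ^+ 2 + b ^+ 2 + c ^+ 2 = 1) :
  exists e : R, [/\ e ^+ 2 = 1, a = e * (y * w1 - w * y1),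
     b = e * (w * x1 - x * w1) & c = e * (x * y1 - y * x1)].
Proof.
have [] := frame_decomposition _ _ _ _ _ _ _ a b c hp hd hpd.
rewrite ha hb !mul0r !add0r; set e := (_ + _ + _) => ea eb ec; exists e; split=> //.
transitivity (a * (e * (y * w1 - w * y1)) + b * (e * (w * x1 - x * w1))
              + c * (e * (x * y1 - y * x1))); first by rewrite /e; ring.
by rewrite -ea -eb -ec -hm; ring.
Qed.

(** * Angle functions and antiderivatives *)

(** With A + iB = (C + iS) exp(-i th), the differential equations give A and B zero derivative, so
    they are constant on [I]; [t0] is the angle of that constant unit vector. *)
Lemma angle_representation (R : realType) (I : set R) (C S th om : R -> R)
    (I0 : I !=set0) (iI : is_interval I)
    (dC : forall l, I l -> is_derive l 1 C (- S l * om l))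
    (dS : forall l, I l -> is_derive l 1 S (C l * om l))
    (dth : forall l, I l -> is_derive l 1 th (om l))
    (CS : forall l, I l -> C l ^+ 2 + S l ^+ 2 = 1) :
  exists t0 : R, forall l, I l -> C l = cos (t0 + th l) /\ S l = sin (t0 + th l).
Proof.
have [l0 Il0] := I0.
pose A l := C l * cos (th l) + S l * sin (th l).
pose B l := S l * cos (th l) - C l * sin (th l).
have dcos l : I l -> is_derive l 1 (cos \o th) (- sin (th l) * om l).
  by move=> /dth ?; apply: is_derive1_comp.
have dsin l : I l -> is_derive l 1 (sin \o th) (cos (th l) * om l).
  by move=> /dth ?; apply: is_derive1_comp.
have dA l : I l -> is_derive l 1 A 0.
  move=> Il.
  apply: (is_derive_eq (is_deriveD (is_deriveM (dC l Il) (dcos l Il))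
                                   (is_deriveM (dS l Il) (dsin l Il)))).
  by rewrite /GRing.scale/=; ring.
have dB l : I l -> is_derive l 1 B 0.
  move=> Il.
  apply: (is_derive_eq (is_deriveB (is_deriveM (dS l Il) (dcos l Il))
                                   (is_deriveM (dC l Il) (dsin l Il)))).
  by rewrite /GRing.scale/=; ring.
have cs1 l := cos2Dsin2 (th l).
have [|t0 [ct0 st0]] := @unit_circle_angle _ (A l0) (B l0).
  transitivity ((C l0 ^+ 2 + S l0 ^+ 2) * (cos (th l0) ^+ 2 + sin (th l0) ^+ 2)).
    by rewrite /A /B; ring.
  by rewrite CS// cs1 mulr1.
exists t0 => l Il.
rewrite cosD sinD ct0 st0 (is_derive_cst_on R I A iI dA l0 l)//.
rewrite (is_derive_cst_on R I B iI dB l0 l)//; split.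
  transitivity (C l * (cos (th l) ^+ 2 + sin (th l) ^+ 2)); first by rewrite cs1 mulr1.
  by rewrite /A /B; ring.
transitivity (S l * (cos (th l) ^+ 2 + sin (th l) ^+ 2)); first by rewrite cs1 mulr1.
by rewrite /A /B; ring.
Qed.

Lemma segment_antiderivative (R : realType) (f : R -> R) (p q : R)
    (cf : forall t, p <= t <= q -> {for t, continuous f}) :
  exists F : R -> R, forall t, p < t < q -> is_derive t 1 F (f t).
Proof.
pose F (t : R) := (\int[lebesgue_measure]_(s in `[p, t]) f s)%R.
exists F => t /andP[pt tq].
have fint : lebesgue_measure.-integrable `[p, q] (EFin \o f).
  apply: continuous_compact_integrable; first exact: segment_compact.
  by apply: continuous_in_subspaceT => s /set_mem; rewrite /= in_itv => /cf.
have [|dF F'] := @continuous_FTC1_closed _ f p t q tq fint pt.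
  by apply: cf; rewrite !ltW.
by rewrite -F' derive1E; apply: derivableP.
Qed.

(** Places two points in the interior of one compact segment inside [I], as [segment_antiderivative]
    requires. *)
Lemma open_interval_segment (R : realType) (I : set R) (oI : open I)
    (iI : is_interval I) (a b : R) (Ia : I a) (Ib : I b) :
  exists p q : R, [/\ p < a < q, p < b < q & forall t, p <= t <= q -> I t].
Proof.
wlog ab : a b Ia Ib / a <= b.
  move=> H; case: (leP a b) => [/H|/ltW/H]; first exact.
  by move=> /(_ Ib Ia)[p [q [? ? ?]]]; exists p, q; split.
have [e /= e0 Be] := (nbhs_ballP _ _).1 (open_nbhs_nbhs (conj oI Ia)).
have [d /= d0 Bd] := (nbhs_ballP _ _).1 (open_nbhs_nbhs (conj oI Ib)).
exists (a - e / 2), (b + d / 2); split; try lra.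
apply: iI; [apply: Be|apply: Bd]; rewrite /ball/=.
  by rewrite opprB addrC subrK gtr0_norm; lra.
by rewrite opprD addNKr normrN gtr0_norm; lra.
Qed.

(** Antiderivatives on compact segments are glued together. Each segment contains the base point
    [l0], and subtracting the value there makes them agree on overlaps. *)
Lemma continuous_antiderivative (R : realType) (I : set R) (f : R -> R)
    (oI : open_interval I) (cf : forall l, I l -> {for l, continuous f}) :
  exists F, antiderivative_on I F f.
Proof.
case: oI => -[l0 Il0] oI iI.
have /choice[G GP] : forall l, exists G : R -> R, I l -> exists p q,
    [/\ p < l < q, p < l0 < q, forall t, p < t < q -> I t &
        forall t, p < t < q -> is_derive t 1 G (f t)].
  (* Nothing is required outside [I]; [id] is a filler. *)
  move=> l; have [Il|nIl] := pselect (I l); last by exists id.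
  have [p [q [plq pl0q pqI]]] := open_interval_segment _ _ oI iI _ _ Il Il0.
  have [G dG] := segment_antiderivative _ f p q (fun t ht => cf t (pqI t ht)).
  exists G => _; exists p, q; split=> // t /andP[pt tq]; apply: pqI.
  by rewrite !ltW.
exists (fun l => G l l - G l l0) => l Il.
have [p [q [plq pl0q pqI dG]]] := GP l Il.
apply: (@near_eq_is_derive _ _ _ (fun t => G l t - G l l0)); last first.
  have ? := dG l plq.
  by apply: is_derive_eq; rewrite subr0.
near=> t.
have ptq : p < t < q.
  by apply/andP; split; near: t; [apply: lt_nbhsr|apply: lt_nbhsl]; case/andP: plq.
have [p' [q' [ptq' pl0q' pqI' dG']]] := GP t (pqI t ptq).
(* On this overlap, an interval containing both [t] and [l0], the two local antiderivatives differ
   by a constant. *)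
pose K := [set s | p < s < q /\ p' < s < q'].
have iK : is_interval K.
  move=> a b [/andP[? ?] /andP[? ?]] [/andP[? ?] /andP[? ?]] z /andP[? ?].
  by split; lra.
have dK s : K s -> is_derive s 1 (G l - G t) 0.
  move=> [/dG ? /dG' ?]; rewrite -(subrr (f s)); exact: is_deriveB.
have := is_derive_cst_on R K _ iK dK t l0 (conj ptq ptq') (conj pl0q pl0q').
rewrite !fctE; lra.
Unshelve. all: by end_near. Qed.

(** * The profile as a unit speed curve on the sphere *)

(** The third coordinate n3 of p x p', and also the squared polar radius of (x, y) times the
    derivative of its polar angle. *)
Definition wronskian {R : realType} (x y : R -> R) (u : R) : R :=
  x u * derive1 y u - y u * derive1 x u.

(* The geodesic curvature det(p, p', p'') in the unit sphere of a unit speed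
   curve p = (x, y, w). *)
Definition profile_curvature {R : realType} (x y w : R -> R) (u : R) : R :=
  derive1 (derive1 x) u * (y u * derive1 w u - w u * derive1 y u)
  + derive1 (derive1 y) u * (w u * derive1 x u - x u * derive1 w u)
  + derive1 (derive1 w) u * wronskian x y u.

Lemma sphere_tangent (R : realType) (J : set R) (x y w : R -> R) (u : R)
    (hM : hyp_rot_surface2 J x y w) (Ju : J u) :
  x u * derive1 x u + y u * derive1 y u + w u * derive1 w u = 0.
Proof.
have [[_ oJ _] [cx cy cw] pos sph arc _ _ _] := hM.
have [[/derivableP dx _ _] [/derivableP dy _ _] [/derivableP dw _ _]] :=
  And3 (cx u Ju) (cy u Ju) (cw u Ju).
rewrite -!derive1E in dx dy dw.
have d := is_deriveD (is_deriveD (is_deriveX 2 dx) (is_deriveX 2 dy)) (is_deriveX 2 dw).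
have := is_derive_eq0_on _ _ _ _ _ _ oJ Ju sph d.
rewrite /GRing.scale/= !expr1.
move: (derive1 x u) (derive1 y u) (derive1 w u) (x u) (y u) (w u).
by move=> x1 y1 w1 x0 y0 w0 h; lra.
Qed.

(** Obtained by differentiating p.p' = 0 and |p'|^2 = 1. These are the components of p'' along p and
    p', so that p'' = -p + k n. *)
Lemma frame_derivatives (R : realType) (J : set R) (x y w : R -> R) (u : R)
    (hM : hyp_rot_surface2 J x y w) (Ju : J u) :
  derive1 (derive1 x) u * x u + derive1 (derive1 y) u * y u
    + derive1 (derive1 w) u * w u = -1 /\
  derive1 (derive1 x) u * derive1 x u + derive1 (derive1 y) u * derive1 y u
    + derive1 (derive1 w) u * derive1 w u = 0.
Proof.
have [[_ oJ _] [cx cy cw] pos sph arc _ _ _] := hM.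
have [[/derivableP dx /derivableP d2x _] [/derivableP dy /derivableP d2y _]
  [/derivableP dw /derivableP d2w _]] := And3 (cx u Ju) (cy u Ju) (cw u Ju).
rewrite -!derive1E in dx dy dw d2x d2y d2w.
split.
  have d := is_deriveD (is_deriveD (is_deriveM dx d2x) (is_deriveM dy d2y))
    (is_deriveM dw d2w).
  have tg t (Jt : J t) := sphere_tangent _ _ _ _ _ _ hM Jt.
  have := is_derive_eq0_on _ _ _ _ _ _ oJ Ju tg d.
  have := arc u Ju; rewrite /GRing.scale/=.
  move: (derive1 (derive1 x) u) (derive1 (derive1 y) u) (derive1 (derive1 w) u).
  move: (derive1 x u) (derive1 y u) (derive1 w u) (x u) (y u) (w u).
  by move=> x1 y1 w1 x0 y0 w0 x2 y2 w2 h1 h2; lra.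
have d := is_deriveD (is_deriveD (is_deriveX 2 d2x) (is_deriveX 2 d2y))
  (is_deriveX 2 d2w).
have := is_derive_eq0_on _ _ _ _ _ _ oJ Ju arc d.
rewrite /GRing.scale/= !expr1.
move: (derive1 (derive1 x) u) (derive1 (derive1 y) u) (derive1 (derive1 w) u).
move: (derive1 x u) (derive1 y u) (derive1 w u).
by move=> x1 y1 w1 x2 y2 w2 h; lra.
Qed.

(** The derivative of p x p' is p x p'' = k (p x n) = -k p'; this is its third coordinate. *)
Lemma is_derive_wronskian (R : realType) (J : set R) (x y w : R -> R) (u : R)
    (hM : hyp_rot_surface2 J x y w) (Ju : J u) :
  is_derive u 1 (wronskian x y) (- profile_curvature x y w u * derive1 w u).
Proof.
have [[_ oJ _] [cx cy cw] pos sph arc _ _ _] := hM.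
have [[/derivableP dx /derivableP d2x _] [/derivableP dy /derivableP d2y _] _] :=
  And3 (cx u Ju) (cy u Ju) (cw u Ju).
rewrite -!derive1E in dx dy d2x d2y.
apply: (is_derive_eq (is_deriveB (is_deriveM dx d2y) (is_deriveM dy d2x))).
rewrite /GRing.scale/=.
have [e1 e2] := frame_derivatives _ _ _ _ _ _ hM Ju.
have e3 := sphere_tangent _ _ _ _ _ _ hM Ju; have e4 := arc u Ju; have e5 := sph u Ju.
have [Ex Ey _] := frame_decomposition _ _ _ _ _ _ _ (derive1 (derive1 x) u)
  (derive1 (derive1 y) u) (derive1 (derive1 w) u) e5 e4 e3.
rewrite -/(wronskian x y u) -/(profile_curvature x y w u) in Ex Ey.
rewrite e1 e2 in Ex Ey; rewrite Ex Ey.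
move: (profile_curvature x y w u) (derive1 x u) (derive1 y u) (derive1 w u)
  (x u) (y u) (w u) e3 e5.
move=> k x1 y1 w1 x0 y0 w0 e3 e5.
(* The third coordinate of p x (p x p') = (p.p') p - |p|^2 p', kept unsimplified so that [ring] can
   match it. *)
have -> : - k * w1 = k * ((x0 * x1 + y0 * y1 + w0 * w1) * w0
    - w1 * (x0 ^+ 2 + y0 ^+ 2 + w0 ^+ 2)) by rewrite e3 e5; ring.
ring.
Qed.

(** The normal at v = 0 is e (n, 0) with e^2 = 1. A square and a product of two curvatures are
    stated because the sign e cancels in both. *)
Lemma curvatures_profile (R : realType) (J : set R) (x y w : R -> R)
    (N : R -> R -> 'rV[R]_4) (u : R) (hM : hyp_rot_surface2 J x y w)
    (hN : unit_normal_field J (surf x y w) N) (Ju : J u) :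
  (lambda (surf x y w) N u 0 * w u) ^+ 2 = wronskian x y u ^+ 2 /\
  kappa (surf x y w) N u 0 * (lambda (surf x y w) N u 0 * w u) =
    profile_curvature x y w u * wronskian x y u.
Proof.
have [[_ oJ _] [cx cy cw] pos sph arc _ _ _] := hM.
have [_ unf tan uu vv] := hN.
have [[dx _ _] [dy _ _] [dw _ _]] := And3 (cx u Ju) (cy u Ju) (cw u Ju).
have wu := pos u Ju; have w0 : w u != 0 by rewrite gt_eqF.
have minkC p q : mink p q = mink q p :> R by rewrite !minkE; ring.
(* At v = 0 the vector r_v is (0, 0, 0, w), so orthogonality kills the last coordinate of the
   normal. *)
have h4 : N u 0 0 (inord 3) = 0.
  have /eqP := vv u 0 Ju; rewrite minkC mink_d_v_surf0 mulf_eq0 oppr_eq0 (negPf w0).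
  by move/eqP.
have h1 : N u 0 0 0 ^+ 2 + N u 0 0 1 ^+ 2 + N u 0 0 (inord 2) ^+ 2 = 1.
  by rewrite -(unf u 0 Ju) minkE h4; ring.
have h2 := tan u 0 Ju; rewrite minkC mink_surf0 in h2.
have h3 := uu u 0 Ju; rewrite minkC d_u_surf// mink_surf0 in h3.
have hpd := sphere_tangent _ _ _ _ _ _ hM Ju.
have [e [e1 E0 E1 E2]] : exists e : R, [/\ e ^+ 2 = 1,
   N u 0 0 0 = e * (y u * derive1 w u - w u * derive1 y u),
   N u 0 0 1 = e * (w u * derive1 x u - x u * derive1 w u) &
   N u 0 0 (inord 2) = e * wronskian x y u].
  apply: unit_normal_cross => //; [exact: sph|exact: arc| |].
    by rewrite -[RHS]h2; ring.
  by rewrite -[RHS]h3; ring.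
(* Here g(r_v, r_v) = -w^2, whose absolute value w^2 divides w times the third coordinate of [N]. *)
have lamE : lambda (surf x y w) N u 0 * w u = N u 0 0 (inord 2).
  rewrite /lambda d_vv_surf mink_surf0 mink_d_v_surf0 d_v_surf !mxE /= inordK//= cosh0.
  by rewrite mulr1 mulNr normrN -expr2 normrX gtr0_norm// /cst; field.
have kapE : kappa (surf x y w) N u 0 = e * profile_curvature x y w u.
  rewrite /kappa (d_uu_surf R J x y w u 0 oJ cx cy cw Ju) mink_surf0 E0 E1 E2
    /profile_curvature.
  move: (wronskian x y u) (derive1 (derive1 x) u) (derive1 (derive1 y) u)
    (derive1 (derive1 w) u).
  by move: (derive1 x u) (derive1 y u) (derive1 w u) => *; ring.
rewrite lamE kapE E2 exprMn e1 mul1r; split; first by [].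
rewrite -[RHS]mul1r -e1; ring.
Qed.

(** * Polar form, range of lambda and the integrand *)

(** The unit vector (X, Y) / rho turns with angular speed [om]. Working with it instead of an angle
    avoids choosing a branch and gives the hypotheses of [angle_representation]. *)
Lemma is_derive_polar (R : realType) (X Y : R -> R) (l X1 Y1 : R)
    (dX : is_derive l 1 X X1) (dY : is_derive l 1 Y Y1)
    (P0 : 0 < X l ^+ 2 + Y l ^+ 2) :
  let rho : R -> R := fun t => Num.sqrt (X t ^+ 2 + Y t ^+ 2) in
  let om := (X l * Y1 - Y l * X1) / (X l ^+ 2 + Y l ^+ 2) in
  is_derive l 1 (fun t => X t / rho t) (- (Y l / rho l) * om) /\
  is_derive l 1 (fun t => Y t / rho t) (X l / rho l * om).
Proof.
move=> rho om.
have r0 : 0 < rho l by rewrite sqrtr_gt0.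
have r2 : X l ^+ 2 + Y l ^+ 2 = rho l ^+ 2 by rewrite sqr_sqrtr// ltW.
have drho : is_derive l 1 rho ((X l * X1 + Y l * Y1) / rho l).
  have d1 := is_deriveD (is_deriveX 2 dX) (is_deriveX 2 dY).
  have d2 : is_derive ((X ^+ 2 + Y ^+ 2) l) 1 Num.sqrt (2 * rho l)^-1.
    exact: is_derive1_sqrt.
  apply: (is_derive_eq (is_derive1_comp d2 d1)).
  rewrite /GRing.scale/= !expr1; move: (rho l) r0 => r r0.
  by field; rewrite gt_eqF.
have dV := is_deriveV (lt0r_neq0 r0) drho.
rewrite /om r2.
(* Serves both coordinates: exchanging X and Y reverses the sign of the angular speed. *)
have key (r p q p1 q1 : R) : r != 0 -> p ^+ 2 + q ^+ 2 = r ^+ 2 ->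
    p * (- r ^- 2 * ((p * p1 + q * q1) / r)) + r^-1 * p1 =
    - (q / r) * ((p * q1 - q * p1) / r ^+ 2).
  move=> r0' pq.
  transitivity ((p1 * (p ^+ 2 + q ^+ 2) - p * (p * p1 + q * q1)) / r ^+ 3).
    by rewrite pq; field.
  by field.
split.
  by apply: (is_derive_eq (is_deriveM dX dV)); apply: key r2; rewrite gt_eqF.
apply: (is_derive_eq (is_deriveM dY dV)); rewrite /GRing.scale/= addrC in r2 *.
by rewrite [X l * X1 + _]addrC key ?gt_eqF// -opprB; ring.
Qed.

(** The cases follow the sign of 1 - c^2, then that of a - c^2. For c^2 >= 1, positivity at a single
    point [l0] already forces c^2 < a. *)
Lemma lambda_range_of_pos (R : realType) (I : set R) (a c : R) (I0 : I !=set0)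
    (hD : forall l, I l -> 0 < (1 - c ^+ 2) * l ^+ 2 + a - c ^+ 2) :
  lambda_range a c I.
Proof.
have [l0 Il0] := I0; have D0 := hD l0 Il0; have l02 := sqr_ge0 l0.
have [c1|c1|c1] := ltgtP (c ^+ 2) 1.
- have [ca|ac] := leP (c ^+ 2) a; first by constructor 3; rewrite le_min ca ltW.
  constructor 1; split=> //; first exact: lt_trans c1.
  move=> l /hD Dl.
  have r : (c ^+ 2 - a) / (1 - c ^+ 2) < l ^+ 2.
    by rewrite ltr_pdivrMr ?subr_gt0//; lra.
  have : Num.sqrt ((c ^+ 2 - a) / (1 - c ^+ 2)) < `|l|.
    rewrite -sqrtr_sqr ltr_sqrt// (le_lt_trans _ r)// divr_ge0// subr_ge0 ltW//.
  by rewrite lter_normr => /orP[?|?]; [right|left; rewrite ltrNr].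
- have h : 0 <= (c ^+ 2 - 1) * l0 ^+ 2 by rewrite mulr_ge0// subr_ge0 ltW.
  have ca : c ^+ 2 < a by lra.
  constructor 2; split=> //; first exact: lt_trans ca.
  move=> l /hD Dl.
  have r : l ^+ 2 < (a - c ^+ 2) / (c ^+ 2 - 1).
    by rewrite ltr_pdivlMr ?subr_gt0//; lra.
  rewrite -ltr_norml -sqrtr_sqr ltr_sqrt//.
  by rewrite divr_gt0// subr_gt0.
- by constructor 3; rewrite le_min c1 lexx andbT; move: D0; rewrite c1; lra.
Qed.

(** Pointwise algebra with [n], [w1], [U1], [W] standing for n3, w', du/dlambda and w. Squares
    determine n and w' up to sign, and [s] supplies the sign of their product with l. *)
Lemma profile_angular_speed (R : realType) (a c l n w1 U1 W : R) (s : bool)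
    (c0 : 0 < c) (L0 : 0 < l ^+ 2 + a) (l0 : l != 0) (w10 : w1 != 0)
    (P0 : 0 < l ^+ 2 + a - c ^+ 2)
    (hW : W = c / Num.sqrt (l ^+ 2 + a))
    (hn : n ^+ 2 = (l * W) ^+ 2)
    (hw : w1 ^+ 2 * (l ^+ 2 + a) = (1 - c ^+ 2) * l ^+ 2 + a - c ^+ 2)
    (hU : w1 * U1 * (l ^+ 2 + a) = - (W * l))
    (hs : l * n * w1 = (-1) ^+ s * `|l * n * w1|) :
  n * U1 / (1 - W ^+ 2) = (-1) ^+ (~~ s) * c ^+ 2 * phi_integrand a c l.
Proof.
rewrite /phi_integrand; rewrite -hw.
set L := Num.sqrt (l ^+ 2 + a) in hW *.
have Lp : 0 < L by rewrite sqrtr_gt0.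
have L2 : l ^+ 2 + a = L ^+ 2 by rewrite sqr_sqrtr// ltW.
rewrite L2 in P0 hU *.
rewrite -exprMn sqrtr_sqr normrM (gtr0_norm Lp).
have Wp : 0 < W by rewrite hW divr_gt0.
have nn : `|n| = `|l| * W.
  by rewrite -sqrtr_sqr hn sqrtr_sqr normrM (gtr0_norm Wp).
rewrite !normrM nn in hs.
have w1p : 0 < `|w1| by rewrite normr_gt0.
have w12 : w1 ^+ 2 = `|w1| ^+ 2 by rewrite real_normK// num_real.
have l2 : l ^+ 2 = `|l| ^+ 2 by rewrite real_normK// num_real.
have nw : n * w1 = (-1) ^+ s * (l * W * `|w1|).
  apply: (mulfI l0); rewrite mulrA hs.
  transitivity ((-1) ^+ s * (`|l| ^+ 2 * W * `|w1|)); first by ring.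
  by rewrite -l2; ring.
have wU : w1 * U1 = - (W * l) / L ^+ 2.
  by rewrite -hU mulfK// expf_neq0 ?gt_eqF.
(* Both products n w1 and w1 U1 are known with their signs; the minus sign in the second turns [s]
   into [~~ s]. *)
have -> : n * U1 = (n * w1) * (w1 * U1) / w1 ^+ 2 by field.
rewrite nw wU w12 hW signrN; move: ((-1) ^+ s : R) `|w1| w1p => sg v vp.
by field; rewrite !gt_eqF// ltW.
Qed.

(** * First integral of the profile and continuity of the integrand *)

(** The unit vector (0, 0, 1) has coordinates w, w' and n3 in the orthonormal frame p, p', n. *)
Lemma wronskian_sqr (R : realType) (J : set R) (x y w : R -> R) (u : R)
    (hM : hyp_rot_surface2 J x y w) (Ju : J u) :
  wronskian x y u ^+ 2 + w u ^+ 2 + derive1 w u ^+ 2 = 1.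
Proof.
have [_ _ _ sph arc _ _ _] := hM.
have [_ _] := frame_decomposition _ _ _ _ _ _ _ 0 0 1 (sph u Ju) (arc u Ju)
  (sphere_tangent _ _ _ _ _ _ hM Ju).
rewrite -/(wronskian x y u) !mul0r !mul1r !add0r => e.
by rewrite [RHS]e; ring.
Qed.

(** The derivative is -2 w' (k n3 - a w), which vanishes by [hk]. *)
Lemma first_integral (R : realType) (J : set R) (x y w : R -> R) (a : R)
    (hM : hyp_rot_surface2 J x y w)
    (hk : forall u, J u -> profile_curvature x y w u * wronskian x y u = a * w u)
    (u v : R) :
  J u -> J v ->
  wronskian x y u ^+ 2 + a * w u ^+ 2 = wronskian x y v ^+ 2 + a * w v ^+ 2.
Proof.
have [[_ _ iJ] [_ _ cw] _ _ _ _ _ _] := hM.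
apply: (is_derive_cst_on R J (fun t => wronskian x y t ^+ 2 + a * w t ^+ 2) iJ) => t Jt.
have [/derivableP dw _ _] := cw t Jt; rewrite -derive1E in dw.
have dn := is_derive_wronskian _ _ _ _ _ _ hM Jt.
have ht := hk t Jt.
apply: (is_derive_eq (is_deriveD (is_deriveX 2 dn) (is_deriveZ a (is_deriveX 2 dw)))).
rewrite /GRing.scale/= !expr1.
transitivity (- 2 * derive1 w t *
  (profile_curvature x y w t * wronskian x y t - a * w t)); last first.
  by rewrite ht subrr mulr0.
by move: (profile_curvature x y w t) (wronskian x y t) (derive1 w t) (w t) => *; ring.
Qed.

Lemma continuous_phi_integrand (R : realType) (a c l : R)
    (L0 : 0 < l ^+ 2 + a) (P0 : l ^+ 2 + a - c ^+ 2 != 0)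
    (D0 : 0 < (1 - c ^+ 2) * l ^+ 2 + a - c ^+ 2) :
  {for l, continuous (phi_integrand a c)}.
Proof.
have cl : {for l, continuous (fun t : R => t ^+ 2)} by apply: exprn_continuous.
have cL : {for l, continuous (fun t : R => t ^+ 2 + a)}.
  by apply: continuousD => //; exact: cst_continuous.
have cP : {for l, continuous (fun t : R => t ^+ 2 + a - c ^+ 2)}.
  by apply: continuousB => //; exact: cst_continuous.
have cD : {for l, continuous (fun t : R => (1 - c ^+ 2) * t ^+ 2 + a - c ^+ 2)}.
  apply: continuousB; last exact: cst_continuous.
  apply: continuousD; last exact: cst_continuous.
  by apply: continuousM => //; exact: cst_continuous.
have csqrt (f : R -> R) : {for l, continuous f} ->
    {for l, continuous (fun t : R => Num.sqrt (f t))}.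
  by move=> cf; apply: continuous_comp => //; exact: sqrt_continuous.
apply: continuousM => //; apply: continuousV.
  by rewrite !mulf_neq0// gt_eqF// sqrtr_gt0.
by apply: continuousM; [apply: continuousM => //; exact: csqrt|exact: csqrt].
Qed.

(** * The profile curve in terms of lambda *)

Theorem corollary3p7 (R : realType) (J I : set R) (x y w U : R -> R)
    (N : R -> R -> 'rV[R]_4) (a : R)
    (hM : hyp_rot_surface2 J x y w)
    (hN : unit_normal_field J (surf x y w) N)
    (hU : lambda_parameter J I (surf x y w) N U)
    (hl0 : forall u v, J u -> lambda (surf x y w) N u v != 0)
    (hW : weingarten J (surf x y w) N (fun l => a / l))
    (hpos : forall l, I l -> 0 < l ^+ 2 + a) :
  (exists K : R, forall u v, J u -> gauss_curvature (surf x y w) N u v = K) /\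
  exists (c phi0 : R) (s : bool) (Phi phi : R -> R),
    [/\ 0 < c,
        forall l, I l -> l ^+ 2 + a - c ^+ 2 != 0 /\
                         0 < (1 - c ^+ 2) * l ^+ 2 + a - c ^+ 2,
        antiderivative_on I Phi (phi_integrand a c) /\
        (forall l, I l -> phi l = phi0 + (-1) ^+ s * c ^+ 2 * Phi l),
        forall l, I l ->
          [/\ w (U l) = c / Num.sqrt (l ^+ 2 + a),
              x (U l) = Num.sqrt (1 - w (U l) ^+ 2) * cos (phi l) &
              y (U l) = Num.sqrt (1 - w (U l) ^+ 2) * sin (phi l)] &
        lambda_range a c I].
Proof.
split.
  (* The product of kappa and lambda is a, so the Gauss equation gives 1 - a. *)
  exists (1 - a) => u v Ju; rewrite /gauss_curvature (hW u v Ju).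
  by rewrite mulrN divfK// hl0.
have [[_ oJ iJ] [cx cy cw] pos sph arc _ _ _] := hM.
have [[[l0 Il0] oI iI] [UJ _ _] dU0 lamU] := hU.
have {}UJ l : I l -> J (U l) by move=> Il; apply: UJ.
have lN0 l : I l -> l != 0 by move=> Il; rewrite -(lamU l 0 Il) hl0//; exact: UJ.
pose n (l : R) : R := wronskian x y (U l); pose w1 (l : R) : R := derive1 w (U l).
pose U1 : R -> R := derive1 U.
have nsq l : I l -> n l ^+ 2 = (l * w (U l)) ^+ 2.
  move=> Il; have [<- _] := curvatures_profile _ _ _ _ _ _ _ hM hN (UJ l Il).
  by rewrite lamU.
have wpos l : I l -> 0 < w (U l) by move=> /UJ/pos.
have n0 l : I l -> n l != 0.
  by move=> Il; rewrite -sqrf_eq0 nsq// sqrf_eq0 mulf_eq0 negb_or lN0//= gt_eqF// wpos.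
have hk u : J u -> profile_curvature x y w u * wronskian x y u = a * w u.
  move=> Ju; have [_ <-] := curvatures_profile _ _ _ _ _ _ _ hM hN Ju.
  by rewrite (hW u 0 Ju) mulrA divfK// hl0.
(* By [first_integral] the radicand has the same value at every point, so the choice of [l0] is
   immaterial. *)
pose c : R := Num.sqrt (n l0 ^+ 2 + a * w (U l0) ^+ 2).
have Epos : 0 < n l0 ^+ 2 + a * w (U l0) ^+ 2.
  rewrite nsq// exprMn -mulrDl mulr_gt0 ?hpos// exprn_gt0// wpos//.
have c0 : 0 < c by rewrite sqrtr_gt0.
have c2 : c ^+ 2 = n l0 ^+ 2 + a * w (U l0) ^+ 2 by rewrite sqr_sqrtr// ltW.
have wc l : I l -> w (U l) ^+ 2 * (l ^+ 2 + a) = c ^+ 2.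
  move=> Il; rewrite c2 /n (first_integral _ _ _ _ _ a hM hk (U l0) (U l))//;
    try exact: UJ.
  by rewrite -/(n l) nsq//; ring.
have wE l : I l -> w (U l) = c / Num.sqrt (l ^+ 2 + a).
  move=> Il; have La := hpos l Il.
  have h : 0 < Num.sqrt (l ^+ 2 + a) by rewrite sqrtr_gt0.
  apply/(canRL (mulfK (lt0r_neq0 h))).
  rewrite -[RHS]gtr0_norm// -sqrtr_sqr -(wc l Il) sqrtrM ?sqr_ge0//.
  by rewrite sqrtr_sqr gtr0_norm ?wpos.
have dU l : I l -> is_derive l 1 U (U1 l).
  by move=> /dU0/derivableP; rewrite -derive1E.
have dw l : I l -> is_derive l 1 (w \o U) (w1 l * U1 l).
  move=> Il; have [/derivableP d _ _] := cw _ (UJ l Il); rewrite -derive1E in d.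
  exact: is_derive1_comp d (dU l Il).
have wU1 l : I l -> w1 l * U1 l * (l ^+ 2 + a) = - (w (U l) * l).
  move=> Il.
  (* The relation [wc] is differentiated in lambda; a factor 2 w then cancels. *)
  have d := is_deriveM (is_deriveX 2 (dw l Il))
    (is_deriveD (is_deriveX 2 (is_derive_id l (1 : R))) (is_derive_cst a l (1 : R))).
  have := is_derive_eq0_on _ _ _ _ _ _ oI Il wc d.
  rewrite /GRing.scale/= !expr1 => h.
  have {}h : w (U l) ^+ 2 * (2 * l * 1 + 0)
    + (l ^+ 2 + a) * (2 * w (U l) * (w1 l * U1 l)) = 0 by exact: h.
  apply: (mulfI (lt0r_neq0 (wpos l Il))); move: h.
  by move: (w (U l)) (w1 l) (U1 l) => *; lra.
have w10 l : I l -> w1 l != 0.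
  move=> Il; apply/eqP => h; move: (wU1 l Il); rewrite h !mul0r => /esym/eqP.
  by rewrite oppr_eq0 mulf_eq0 (negPf (lN0 l Il)) gt_eqF// wpos.
have w1D l : I l -> w1 l ^+ 2 * (l ^+ 2 + a) = (1 - c ^+ 2) * l ^+ 2 + a - c ^+ 2.
  move=> Il; have e := wronskian_sqr _ _ _ _ _ _ hM (UJ l Il).
  rewrite -/(n l) nsq// -/(w1 l) in e; have e2 := wc l Il.
  (* Uses n3^2 = lambda^2 w^2; multiplying by lambda^2 + a and applying [wc] produces the radicand
     of the integrand. *)
  have -> : w1 l ^+ 2 = 1 - w (U l) ^+ 2 * (1 + l ^+ 2).
    by move: (w (U l)) (w1 l) e => ? ? ?; lra.
  by rewrite -e2; ring.
have Dpos l : I l -> 0 < (1 - c ^+ 2) * l ^+ 2 + a - c ^+ 2.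
  move=> Il; rewrite -w1D// mulr_gt0 ?hpos// lt_def sqr_ge0 andbT sqrf_eq0.
  exact: w10.
have rho2 l : I l -> x (U l) ^+ 2 + y (U l) ^+ 2 = 1 - w (U l) ^+ 2.
  by move=> Il; rewrite -(sph _ (UJ l Il)); ring.
have rpos l : I l -> 0 < 1 - w (U l) ^+ 2.
  move=> Il; rewrite -rho2// lt_def addr_ge0 ?sqr_ge0// andbT.
  (* At a point with x = y = 0 the Wronskian would vanish, against [n0]; hence the polar radius is
     positive. *)
  rewrite paddr_eq0 ?sqr_ge0// !sqrf_eq0; apply/negP => /andP[/eqP x0 /eqP y0].
  by have /eqP := n0 l Il; apply; rewrite /n /wronskian x0 y0 !mul0r subrr.
have cpos l : I l -> 0 < l ^+ 2 + a - c ^+ 2.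
  move=> Il; have -> : l ^+ 2 + a - c ^+ 2 = (1 - w (U l) ^+ 2) * (l ^+ 2 + a).
    by rewrite -(wc l Il); ring.
  by rewrite mulr_gt0 ?rpos ?hpos.
have cf l : I l -> {for l, continuous (fun t : R => t * n t * w1 t : R)}.
  move=> Il; have [_ /derivableP d _] := cw _ (UJ l Il); rewrite -derive1E in d.
  have dn := is_derive_wronskian _ _ _ _ _ _ hM (UJ l Il).
  have [D _] := is_deriveM (is_deriveM (is_derive_id l (1 : R))
    (is_derive1_comp dn (dU l Il))) (is_derive1_comp d (dU l Il)).
  by apply: differentiable_continuous; apply/derivable1_diffP; exact: D.
have f0 l : I l -> l * n l * w1 l != 0.
  by move=> Il; rewrite !mulf_eq0 !negb_or lN0// n0// w10.
have [s hs] := continuous_neq0_sign R I _ iI cf f0.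
have [l|Phi dPhi] := continuous_antiderivative R I (phi_integrand a c)
  (And3 (ex_intro _ l0 Il0) oI iI).
  move=> Il; apply: continuous_phi_integrand; [exact: hpos| |exact: Dpos].
  by rewrite gt_eqF// cpos.
pose X := x \o U; pose Y := y \o U.
pose rho (l : R) : R := Num.sqrt (X l ^+ 2 + Y l ^+ 2).
pose om (l : R) : R := (-1) ^+ (~~ s) * c ^+ 2 * phi_integrand a c l.
have polar l : I l ->
    is_derive l 1 (fun t => X t / rho t) (- (Y l / rho l) * om l) /\
    is_derive l 1 (fun t => Y t / rho t) (X l / rho l * om l).
  move=> Il; have [/derivableP dx _ _] := cx _ (UJ l Il).
  have [/derivableP dy _ _] := cy _ (UJ l Il).
  rewrite -!derive1E in dx dy.
  have P0 : 0 < X l ^+ 2 + Y l ^+ 2 by rewrite rho2// rpos.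
  have := is_derive_polar _ _ _ _ _ _ (is_derive1_comp dx (dU l Il))
    (is_derive1_comp dy (dU l Il)) P0.
  (* By the chain rule the numerator is n3 du/dlambda, and rho^2 = 1 - w^2, which is the quotient in
     [profile_angular_speed]. *)
  suff -> : (X l * (derive1 y (U l) * U1 l) - Y l * (derive1 x (U l) * U1 l)) /
    (X l ^+ 2 + Y l ^+ 2) = om l by [].
  rewrite /om -(profile_angular_speed _ a c l (n l) (w1 l) (U1 l) (w (U l)) s)//; 
    [|exact: hpos|exact: lN0|exact: w10|exact: cpos|exact: wE
    |exact: nsq|exact: w1D|exact: wU1|exact: hs].
  rewrite /X /Y [in LHS]/= rho2// /n /wronskian; congr (_ / _).
  by move: (U1 l) (x (U l)) (y (U l)) (derive1 x _) (derive1 y _) => *; ring.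
have rp l : I l -> 0 < rho l by move=> Il; rewrite sqrtr_gt0 rho2// rpos.
(* The unit vector (x, y) / rho and the signed integral have the same angular speed [om]; [phi0] is
   the constant difference of angles. *)
have [||||phi0 hphi] := angle_representation R I (fun t => X t / rho t)
    (fun t => Y t / rho t) (fun l => (-1) ^+ (~~ s) * c ^+ 2 * Phi l) om
    (ex_intro _ l0 Il0) iI.
- by move=> l /polar[].
- by move=> l /polar[].
- by move=> l /dPhi d; exact: is_deriveZ.
- move=> l Il; rewrite !expr_div_n -mulrDl sqr_sqrtr ?addr_ge0 ?sqr_ge0// divff//.
  by rewrite rho2// gt_eqF// rpos.
exists c, phi0, (~~ s), Phi, (fun l => phi0 + (-1) ^+ (~~ s) * c ^+ 2 * Phi l).
split=> //; last 1 first.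
- by apply: lambda_range_of_pos => //; exists l0.
- by move=> l Il; split; [rewrite gt_eqF// cpos|exact: Dpos].
move=> l Il; have [hx hy] := hphi l Il.
have rE : rho l = Num.sqrt (1 - w (U l) ^+ 2) by rewrite /rho rho2.
rewrite -hx -hy -rE; split; first exact: wE.
  by rewrite mulrC divfK// gt_eqF// rp.
by rewrite mulrC divfK// gt_eqF// rp.
Qed.
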